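(* Let $G$ be a connected graph on $n \ge 2$ vertices, labelled $1,\dots,n$, with adjacency matrix $A \in \mathbb{R}^{n\times n}$ and spectral radius $\rho = \rho(G)$. Let $x=(x_1,\dots,x_n)^T$ be the principal eigenvector of $G$, i.e. the entrywise positive vector satisfying $Ax=\rho x$ and $\sum_{j=1}^{n} x_j^2 = 1$. For each vertex $i$, let $d_i$ be the degree of vertex $i$ in $G$, and let $\rho_i$ be the spectral radius of the graph $G_{(i)}$ obtained from $G$ by deleting vertex $i$ and all edges incident to it. Then for every $1 \le i \le n$: $$ x_i \geq \frac{1}{\sqrt{1+\dfrac{d_i}{(\rho-\rho_i)^2}}}. $$
   Context: Graphs are finite, simple and undirected. The spectral radius of a graph is the spectral radius (equivalently, the largest eigenvalue) of its adjacency matrix. For a connected graph $G$, the spectral radius $\rho(G)$ is a simple eigenvalue of the adjacency matrix $A$ and has an entrywise positive eigenvector; the principal eigenvector (Perron vector) of $G$ is this positive eigenvector, normalized to have Euclidean norm $1$. Since $G$ is connected, $\rho > \rho_i$ for every vertex $i$, so the expression in the bound is well defined. *)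

(* Defs.v *)
From mathcomp Require Import all_boot all_order all_algebra.
From mathcomp Require Import complex.
From mathcomp Require Import boolp classical_sets reals.

Set Implicit Arguments.
Unset Strict Implicit.
Unset Printing Implicit Defensive.

Import Order.TTheory GRing.Theory Num.Theory.
Local Open Scope ring_scope.

(* Maximum modulus of the complex eigenvalues. They are finitely many, and
   exist when n > 0, so that sup is a maximum; for n = 0 it is the junk
   value sup set0 = 0. The norm of R[i] takes values in R[i], whence Re. *)
Definition spectral_radius (R : realType) (n : nat) (A : 'M[R]_n) : R :=
  sup [set r : R | exists2 z : R[i],
         eigenvalue (map_mx (real_complex R) A) z & r = complex.Re `|z|]%classic.

(* A simple graph on 'I_n is given by its edge relation. *)
Definition simple_graph (n : nat) (e : rel 'I_n) : Prop :=
  symmetric e /\ irreflexive e.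

Definition connected_graph (n : nat) (e : rel 'I_n) : Prop :=
  forall i j : 'I_n, connect e i j.

Definition degree (n : nat) (e : rel 'I_n) (i : 'I_n) : nat :=
  #|[set j | e i j]|.

Definition adjacency_matrix (R : realType) (n : nat) (e : rel 'I_n) : 'M[R]_n :=
  \matrix_(i, j) (e i j)%:R.

Definition graph_spectral_radius (R : realType) (n : nat) (e : rel 'I_n) : R :=
  spectral_radius (adjacency_matrix R e).

(* The remaining vertices are relabelled by the increasing bijection
   lift i : 'I_n.-1 -> 'I_n \ {i}. *)
Definition delete_vertex (n : nat) (e : rel 'I_n) (i : 'I_n) : rel 'I_n.-1 :=
  fun j k => e (lift i j) (lift i k).

Definition principal_eigenvector (R : realType) (n : nat) (e : rel 'I_n)
    (x : 'cV[R]_n) : Prop :=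
  [/\ forall j, 0 < x j 0,
      adjacency_matrix R e *m x = graph_spectral_radius R e *: x
    & \sum_j x j 0 ^+ 2 = 1].

(* Main.v *)
Require Import Defs.
From mathcomp Require Import all_boot all_order all_algebra.
From mathcomp Require Import reals.
From mathcomp Require Import spectral complex boolp classical_sets.
From mathcomp Require Import ring lra.

Set Implicit Arguments.
Unset Strict Implicit.
Unset Printing Implicit Defensive.

Import Order.TTheory GRing.Theory Num.Theory.
Local Open Scope ring_scope.
Local Open Scope sesquilinear_scope.

(** Split the eigenvector as [x = (x_i, y)], and let [b] be the 0-1 vector of
    the neighbours of [i] and [B] the adjacency matrix of [G - i].  The rows of
    [A x = rho x] other than the [i]-th read [rho y = x_i b + B y], so that
    [rho |y|^2 - y^T B y = x_i <b, y>].  Since [B] is symmetric,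
    [y^T B y <= rho_i |y|^2] ([rayleigh_le_spectral_radius]).  With
    [delta = rho - rho_i] this gives [delta |y|^2 <= x_i <b, y>], and
    [x_i <b, y> <= delta/2 |y|^2 + x_i^2/(2 delta) |b|^2] by completing the
    square.  As [|b|^2 = d_i], it follows that
    [delta^2 |y|^2 <= x_i^2 d_i], hence
    [1 = x_i^2 + |y|^2 <= x_i^2 (1 + d_i / delta^2)], which is the bound.

    The division by [delta] needs [rho_i < rho]
    ([delete_vertex_spectral_radius_lt]).  The moduli of the entries of a
    dominant eigenvector of [B] form a nonzero [w >= 0] with
    [rho_i w <= B w].  If [rho <= rho_i], extending [w] by zero at [i] yields a
    vector with [rho w <= A w].  Pairing with the positive eigenvector [x]
    turns this into an equality, and then the zero of [w] at [i] spreads along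
    the edges to the whole connected graph ([subinvariant_eq0]), so [w = 0]. *)

Local Notation toC R := (real_complex R).

Lemma Re_normC (R : rcfType) (z : R[i]) : toC R (complex.Re `|z|) = `|z|.
Proof. by rewrite RRe_real // normr_real. Qed.

(** The supremum is a maximum because the eigenvalues are the finitely many
    roots of the characteristic polynomial, and one exists because the complex
    numbers are algebraically closed. *)
Lemma spectral_radius_max (R : realType) (n : nat) (A : 'M[R]_n) :
  (0 < n)%N ->
  exists z : R[i],
    [/\ eigenvalue (map_mx (toC R) A) z, spectral_radius A = complex.Re `|z|
      & forall t, eigenvalue (map_mx (toC R) A) t ->
          complex.Re `|t| <= complex.Re `|z|].
Proof.
case: n A => // n A _.
pose M := map_mx (toC R) A.
have [s sE] := closed_field_poly_normal (char_poly M).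
have mems z : (z \in s) = eigenvalue M z.
  rewrite eigenvalue_root_char sE rootZ ?root_prod_XsubC //.
  by rewrite lead_coef_eq0 monic_neq0 // char_poly_monic.
have [z0 z0M] : exists z, eigenvalue M z by apply: eigenvalue_closed.
pose N (z : R[i]) := complex.Re `|z|.
have z0s : z0 \in s by rewrite mems.
have [/= zm _ zmmax] :=
  arg_maxP (fun t : seq_sub s => N (val t)) (erefl : xpredT (SeqSub z0s)).
have N_le t : eigenvalue M t -> N t <= N (val zm).
  by rewrite -mems => ts; apply: (zmmax (SeqSub ts)).
have zmM : eigenvalue M (val zm) by rewrite -mems (valP zm).
exists (val zm); split; [exact: zmM | | exact: N_le].
apply/le_anti/andP; split.
  apply: ge_sup; first by exists (N z0); exists z0; first exact: z0M.
  by move=> _ [t tM ->]; exact: N_le.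
apply: ub_le_sup; last by exists (val zm); first exact: zmM.
exists (N (val zm)) => _ [t tM ->]; exact: N_le.
Qed.

(** Over the complex numbers a real symmetric matrix is Hermitian, so it is
    diagonalised by a unitary matrix, with real diagonal entries that are
    eigenvalues and hence bounded by the spectral radius. *)
Lemma rayleigh_le_spectral_radius (R : realType) (n : nat) (A : 'M[R]_n)
    (v : 'cV[R]_n) :
  A^T = A ->
  (v^T *m (A *m v)) 0 0 <= spectral_radius A * \sum_j v j 0 ^+ 2.
Proof.
move=> symA; pose M := map_mx (toC R) A.
have hM : M \is hermsymmx.
  apply: realsym_hermsym.
    apply/is_hermitianmxP; rewrite expr0 scale1r map_mx_id //.
    by apply/matrixP => j k; rewrite !mxE -[in LHS]symA mxE.
  by apply/mxOverP => j k; rewrite mxE; apply/complex_realP; exists (A j k).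
have ME := orthomx_spectralP (hermitian_normalmx hM).
have := mxOverP (hermitian_spectral_diag_real hM).
move: (spectral_unitarymx M) ME.
set P := spectralmx M; set d := spectral_diag M => uP ME dreal.
have Punit := unitarymx_unit uP.
have d_le j : d 0 j <= toC R (spectral_radius A).
  have dM : eigenvalue M (d 0 j).
    apply/eigenvalueP; exists (row j P).
      by rewrite -row_mul ME !mulmxA mulmxV // mul1mx row_mul row_diag_mx
        -scalemxAl -rowE.
    apply/eqP => Pj0; have := mxrank_unitary uP.
    move/eqP; rewrite -/(row_free P) => /row_freeP [Q PQ].
    have := congr1 (fun X => row j X 0 j) PQ.
    rewrite row_mul Pj0 mul0mx !mxE eqxx.
    by move/esym/eqP; rewrite oner_eq0.
  apply: (le_trans (real_ler_norm _)); first exact: dreal.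
  have n_gt0 : (0 < n)%N := leq_ltn_trans (leq0n j) (ltn_ord j).
  have [z [_ -> /(_ _ dM) le_z]] := spectral_radius_max A n_gt0.
  by rewrite -Re_normC lecR.
(* In the coordinates [u] of an orthonormal eigenbasis the quadratic form is
   diagonal, and unitarity of [P] keeps the norm. *)
pose u := P *m map_mx (toC R) v.
have uTE : u ^t* = (map_mx (toC R) v)^T *m P ^t*.
  rewrite /u trmx_mul map_mxM /=; congr (_ *m _).
  by apply/matrixP => j k; rewrite !mxE conj_Creal //; apply/complex_realP;
    eexists.
have normE : toC R (\sum_j v j 0 ^+ 2) = \sum_j `|u j 0| ^+ 2.
  transitivity ((u ^t* *m u) 0 0); last first.
    by rewrite mxE; apply: eq_bigr => j _; rewrite !mxE normCKC.
  rewrite uTE /u mulmxA -(mulmxA _ _ P) -invmx_unitary // mulVmx // mulmx1.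
  by rewrite !mxE rmorph_sum; apply: eq_bigr => j _; rewrite !mxE rmorphXn expr2.
have quadE : toC R ((v^T *m (A *m v)) 0 0) = \sum_j d 0 j * `|u j 0| ^+ 2.
  transitivity ((u ^t* *m diag_mx d *m u) 0 0); last first.
    rewrite mxE; apply: eq_bigr => j _; rewrite mul_mx_diag !mxE normCKC.
    by rewrite mulrAC mulrC.
  rewrite uTE -invmx_unitary // /u !mulmxA -(mulmxA _ _ (diag_mx d)).
  rewrite -(mulmxA _ _ P) -ME /M map_trmx -!map_mxM -mulmxA.
  by rewrite [RHS]mxE.
rewrite -lecR quadE rmorphM /= normE mulr_sumr.
by apply: ler_sum => j _; apply: ler_wpM2r; rewrite ?exprn_ge0.
Qed.

(** The half of Perron-Frobenius theory used here: take the moduli of the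
    entries of an eigenvector for an eigenvalue of maximal modulus and apply
    the triangle inequality. *)
Lemma nonneg_mx_subinvariant (R : realType) (n : nat) (A : 'M[R]_n) :
  (0 < n)%N -> (forall j k, 0 <= A j k) ->
  exists w : 'I_n -> R,
    [/\ forall j, 0 <= w j, exists j, w j != 0
      & forall j, spectral_radius A * w j <= \sum_k w k * A k j].
Proof.
move=> n_gt0 A_ge0.
have [z [/eigenvalueP [v vM v_neq0] -> _]] := spectral_radius_max A n_gt0.
exists (fun j => complex.Re `|v 0 j|); split.
- by move=> j; rewrite -ler0c Re_normC.
- have /rV0Pn [j vj] := v_neq0; exists j.
  by apply: contra vj => /eqP wj0; rewrite -normr_eq0 -Re_normC wj0.
move=> j; rewrite -lecR.
have toCM a b : toC R (a * b) = toC R a * toC R b by rewrite rmorphM.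
have toC_sum (F : 'I_n -> R) : toC R (\sum_k F k) = \sum_k toC R (F k).
  by rewrite rmorph_sum.
rewrite toCM toC_sum !Re_normC -normrM.
have := congr1 (fun u : 'rV_n => u 0 j) vM; rewrite /= !mxE => <-.
apply: le_trans (ler_norm_sum _ _ _) _.
apply: ler_sum => k _.
have A_ge0C : 0 <= toC R (A k j) by rewrite ler0c.
by rewrite toCM Re_normC normrM mxE (ger0_norm A_ge0C).
Qed.

(** A maximum principle: if [r] has a positive eigenvector [x], pairing the
    inequality [r w <= A w] with [x] leaves no slack, so [w] is itself an
    eigenvector for [r]; a nonnegative eigenvector on a connected graph that
    vanishes at one vertex vanishes everywhere. *)
Lemma subinvariant_eq0 (R : realType) (n : nat) (e : rel 'I_n)
    (x : 'cV[R]_n) (r : R) (w : 'I_n -> R) (i : 'I_n) :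
  symmetric e -> connected_graph e ->
  (forall j, 0 < x j 0) -> adjacency_matrix R e *m x = r *: x ->
  (forall j, 0 <= w j) ->
  (forall j, r * w j <= \sum_k w k * (e k j)%:R) ->
  w i = 0 -> forall j, w j = 0.
Proof.
move=> sym_e conn x_gt0 Ax w_ge0 w_sub wi0.
have AxE k : \sum_j (e k j)%:R * x j 0 = r * x k 0.
  have := congr1 (fun u : 'cV_n => u k 0) Ax; rewrite /= !mxE => <-.
  by apply: eq_bigr => j _; rewrite mxE.
(* By symmetry [<x, A w - r w> = <A x - r x, w> = 0]. *)
have gap0 : \sum_j x j 0 * (\sum_k w k * (e k j)%:R - r * w j) = 0.
  under eq_bigr => j _ do rewrite mulrBr mulr_sumr.
  rewrite sumrB exchange_big /= -sumrB big1 // => k _.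
  rewrite mulrCA [x k 0 * w k]mulrC mulrCA -AxE mulr_sumr -sumrB big1 // => j _.
  by rewrite mulrCA [x j 0 * _]mulrC subrr.
have w_inv j : \sum_k w k * (e k j)%:R = r * w j.
  have gap_ge0 l : true -> 0 <= x l 0 * (\sum_k w k * (e k l)%:R - r * w l).
    by move=> _; rewrite mulr_ge0 ?subr_ge0 // ltW.
  have := psumr_eq0P gap_ge0 gap0 (i := j) isT.
  by move/eqP; rewrite mulf_eq0 gt_eqF //= subr_eq0 => /eqP.
(* At a zero of [w] the neighbouring values are nonnegative with sum zero. *)
have step j k : e j k -> w j = 0 -> w k = 0.
  move=> ejk wj0; have := w_inv j; rewrite wj0 mulr0 => sum0.
  have t_ge0 l : true -> 0 <= w l * (e l j)%:R by rewrite mulr_ge0 // ler0n.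
  have := psumr_eq0P t_ge0 sum0 (i := k) isT.
  by rewrite sym_e ejk mulr1.
move=> j; have /connectP [p] := conn i j.
elim: p i wi0 => [|k p IHp] l wl0 /=; first by move=> _ ->.
by case/andP=> elk /(IHp k); apply; apply: step wl0.
Qed.

(** Were the inequality to fail, a subinvariant vector of the smaller graph,
    extended by zero at [i], would satisfy the hypotheses of the maximum
    principle above and thus vanish. *)
Lemma delete_vertex_spectral_radius_lt (R : realType) (n : nat) (e : rel 'I_n)
    (x : 'cV[R]_n) (i : 'I_n) :
  (2 <= n)%N -> symmetric e -> connected_graph e -> principal_eigenvector e x ->
  graph_spectral_radius R (delete_vertex e i) < graph_spectral_radius R e.
Proof.
move=> n_ge2 sym_e conn [x_gt0 Ax _]; rewrite ltNge; apply/negP => le_rho.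
have B_ge0 j k : 0 <= adjacency_matrix R (delete_vertex e i) j k.
  by rewrite mxE ler0n.
have n1_gt0 : (0 < n.-1)%N by rewrite -subn1 subn_gt0.
have [w [w_ge0 [j0 wj0] w_sub]] := nonneg_mx_subinvariant n1_gt0 B_ge0.
pose w' j := oapp w 0 (unlift i j).
have w'i : w' i = 0 by rewrite /w' unlift_none.
have w'l k : w' (lift i k) = w k by rewrite /w' liftK.
have w'_ge0 j : 0 <= w' j by rewrite /w'; case: unliftP => /=.
case/eqP: wj0; rewrite -w'l.
apply: (subinvariant_eq0 sym_e conn x_gt0 Ax w'_ge0 _ w'i) => j.
rewrite (bigD1_ord i) //= w'i mul0r add0r.
case: (unliftP i j) => [k|] ->; last first.
  by rewrite w'i mulr0 sumr_ge0 // => k _; rewrite mulr_ge0 ?ler0n.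
rewrite w'l; apply: le_trans (ler_wpM2r (w_ge0 k) le_rho) _.
apply: le_trans (w_sub k) _; apply: ler_sum => l _.
by rewrite w'l mxE.
Qed.

Theorem theorem5 (R : realType) (n : nat) (hn : (2 <= n)%N)
    (e : rel 'I_n) (he : simple_graph e) (hc : connected_graph e)
    (x : 'cV[R]_n) (hx : principal_eigenvector e x) (i : 'I_n) :
  1 / Num.sqrt (1 + (degree e i)%:R /
        (graph_spectral_radius R e
         - graph_spectral_radius R (delete_vertex e i)) ^+ 2) <= x i 0.
Proof.
have [sym_e irr_e] := he.
have := delete_vertex_spectral_radius_lt i hn sym_e hc hx.
have [x_gt0 Ax x_norm] := hx.
rewrite -subr_gt0; set rho := graph_spectral_radius R e.
set B := delete_vertex e i; set rho_i := graph_spectral_radius R B.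
set delta := rho - rho_i => delta_gt0.
pose y : 'cV[R]_n.-1 := \col_k x (lift i k) 0.
pose b k : R := (e i (lift i k))%:R.
pose s := \sum_k y k 0 ^+ 2.
have normE : x i 0 ^+ 2 + s = 1.
  rewrite -x_norm (bigD1_ord i) //=; congr (_ + _).
  by apply: eq_bigr => k _; rewrite mxE.
have degE : \sum_k b k ^+ 2 = (degree e i)%:R.
  rewrite /degree -sum1_card natr_sum [RHS]big_mkcond (bigD1_ord i) //=.
  rewrite inE irr_e add0r; apply: eq_bigr => k _.
  by rewrite inE /b; case: (e _ _); rewrite ?expr1n // expr0n.
have quadE : (y^T *m (adjacency_matrix R B *m y)) 0 0
    = rho * s - x i 0 * \sum_k b k * y k 0.
  rewrite mxE !mulr_sumr -sumrB; apply: eq_bigr => k _.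
  have eqk : b k * x i 0 + \sum_l (B k l)%:R * y l 0 = rho * y k 0.
    have := congr1 (fun u : 'cV_n => u (lift i k) 0) Ax.
    rewrite /= [LHS]mxE (bigD1_ord i) //= !mxE sym_e => <-; congr (_ + _).
    by apply: eq_bigr => l _; rewrite !mxE.
  rewrite [y^T _ _]mxE [(_ *m _) _ _]mxE.
  under eq_bigr => l _ do rewrite mxE.
  by rewrite expr2 mulrA -eqk; ring.
have rayl : delta * s <= x i 0 * \sum_k b k * y k 0.
  have symB : (adjacency_matrix R B)^T = adjacency_matrix R B.
    by apply/matrixP => j k; rewrite !mxE /B /delete_vertex sym_e.
  have := rayleigh_le_spectral_radius y symB; rewrite quadE -/s.
  rewrite -/(graph_spectral_radius R B) -/rho_i /delta; lra.
(* The difference of the two sides is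
   [\sum_k (delta y_k - x_i b_k)^2 / (2 delta)]. *)
have young : x i 0 * (\sum_k b k * y k 0)
    <= delta / 2 * s + x i 0 ^+ 2 / (2 * delta) * (degree e i)%:R.
  rewrite /s -degE !mulr_sumr -big_split; apply: ler_sum => k _ /=.
  rewrite -subr_ge0.
  have -> : delta / 2 * y k 0 ^+ 2 + x i 0 ^+ 2 / (2 * delta) * b k ^+ 2
      - x i 0 * (b k * y k 0)
      = (delta * y k 0 - x i 0 * b k) ^+ 2 / (2 * delta).
    by field; rewrite gt_eqF.
  by rewrite divr_ge0 ?sqr_ge0 // mulr_ge0 // ltW.
set D := (degree e i)%:R in young *.
have q_gt0 : 0 < 1 + D / delta ^+ 2.
  by rewrite ltr_pwDl // divr_ge0 ?ler0n ?sqr_ge0.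
rewrite ler_pdivrMr ?sqrtr_gt0 //.
rewrite -(ler_pXn2r (n := 2)) ?nnegrE ?mulr_ge0 ?sqrtr_ge0 ?(ltW (x_gt0 i)) //.
rewrite expr1n exprMn sqr_sqrtr ?(ltW q_gt0) // -{1}normE mulrDr mulr1 lerD2l.
rewrite -(ler_pM2l delta_gt0).
have -> : delta * (x i 0 ^+ 2 * (D / delta ^+ 2))
    = 2 * (x i 0 ^+ 2 / (2 * delta) * D) by field; rewrite gt_eqF.
lra.
Qed.
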